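(* Let $K$ be a compact line, $L$ be a countable compact Hausdorff space and $\phi:K\to L$ be a continuous surjection. Assume that, for each $p\in L$, $\phi^{-1}(p)$ is a countable union of intervals of $K$ (this is the case, for instance, if $L$ is a compact line and $\phi$ is increasing). Then $\phi^*C(L)$ has the $c_0$-extension property with constant $2$ in $C(K)$.
   Context: All Banach spaces are real. A compact line is a linearly ordered set which is compact in the order topology. An interval of $K$ is an order-convex subset of $K$. ''Increasing'' means order preserving in the non-strict sense. For a compact Hausdorff space $K$, $C(K)$ denotes the Banach space of real-valued continuous functions on $K$ with the supremum norm. For a continuous map $\phi:K\to L$ between compact Hausdorff spaces, $\phi^*:C(L)\to C(K)$ is the composition map $f\mapsto f\circ\phi$, and $\phi^*C(L)$ denotes its range. Given $\lambda\ge1$, a closed subspace $Y$ of a Banach space $X$ has the $c_0$-extension property with constant $\lambda$ in $X$ if every bounded linear operator $T:Y\to c_0$ admits a bounded linear extension $T':X\to c_0$ with $\Vert T'\Vert\le\lambda\Vert T\Vert$. *)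

(* Defs.v *)
From HB Require Import structures.
From mathcomp Require Import all_boot all_order all_algebra.
From mathcomp Require Import ring.
From mathcomp Require Import all_classical all_reals all_analysis.

Set Implicit Arguments.
Unset Strict Implicit.
Unset Printing Implicit Defensive.

Import Order.TTheory GRing.Theory Num.Theory.
Import numFieldNormedType.Exports.

Local Open Scope classical_set_scope.
Local Open Scope ring_scope.

(** Sup norm of a real function. The value is meaningful only for bounded
    functions; it is 0 when the domain is empty. *)
Definition sup_norm (R : realType) (T : Type) (f : T -> R) : R :=
  sup (range (fun t => `|f t|)).

Section sup_norm.
Context (R : realType) (T : Type).
Implicit Types f g : T -> R.

Lemma le_sup_norm f (M : R) t : (forall x, `|f x| <= M) -> `|f t| <= sup_norm f.
Proof.
move=> fM; apply: ub_le_sup; last by exists t.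
by exists M => _ [x _ <-].
Qed.

Lemma sup_norm_ge0 f : 0 <= sup_norm f.
Proof.
rewrite /sup_norm; set E := (X in sup X).
have [[[_ [x _ _]] ubE]|/sup_out->//] := pselect (has_sup E).
by rewrite (le_trans (normr_ge0 (f x)))//; apply: ub_le_sup => //; exists x.
Qed.

Lemma sup_norm_le f (M : R) : 0 <= M -> (forall x, `|f x| <= M) ->
  sup_norm f <= M.
Proof.
move=> M0 fM; rewrite /sup_norm.
have [->|/set0P ne] := eqVneq (range (fun t => `|f t|)) set0; first by rewrite sup0.
by apply: ge_sup => // _ [x _ <-].
Qed.

Lemma sup_normD f g (M N : R) : (forall x, `|f x| <= M) -> (forall x, `|g x| <= N) ->
  sup_norm (f \+ g) <= sup_norm f + sup_norm g.
Proof.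
move=> fM gN; apply: sup_norm_le => [|x]; first by rewrite addr_ge0 ?sup_norm_ge0.
by rewrite (le_trans (ler_normD _ _))// lerD// (le_sup_norm _ fM, le_sup_norm _ gN).
Qed.

Lemma sup_normZ (a : R) f (M : R) : (forall x, `|f x| <= M) ->
  sup_norm (fun x => a * f x) = `|a| * sup_norm f.
Proof.
move=> fM; have af x : `|a * f x| <= `|a| * sup_norm f.
  by rewrite normrM ler_wpM2l// (le_sup_norm _ fM).
apply/eqP; rewrite eq_le sup_norm_le ?mulr_ge0 ?sup_norm_ge0//=.
have [->|a0] := eqVneq a 0; first by rewrite normr0 mul0r sup_norm_ge0.
rewrite mulrC -ler_pdivlMr ?normr_gt0//; apply: sup_norm_le => [|x].
  by rewrite divr_ge0// sup_norm_ge0.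
rewrite ler_pdivlMr ?normr_gt0// mulrC -normrM.
exact: (@le_sup_norm (fun x => a * f x) _ x af).
Qed.

Lemma sup_norm0_eq0 f (M : R) : (forall x, `|f x| <= M) -> sup_norm f = 0 ->
  forall x, f x = 0.
Proof.
move=> fM f0 x; apply/eqP; rewrite -normr_eq0 eq_le normr_ge0 andbT -f0.
exact: le_sup_norm fM.
Qed.

End sup_norm.

(** The Banach space C(K). The compactness proof is a parameter of the type
    because the sup norm is a norm only when continuous functions are bounded. *)
Definition cspace (R : realType) (K : topologicalType)
  (cK : compact [set: K]) : Type := continuousType K R.

Section cspace.
Context (R : realType) (K : topologicalType) (cK : compact [set: K]).
Local Notation C := (cspace R cK).
Implicit Types f g h : C.

HB.instance Definition _ := Choice.copy C (continuousType K R).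

Definition cfun f : K -> R := f.

Lemma cspaceP f g : cfun f =1 cfun g -> f = g.
Proof. by move=> fg; apply/continuousEP. Qed.

Lemma cfun_continuous f : continuous (cfun f).
Proof. exact: cts_fun. Qed.

Let zero : C := cst 0.
Let addP f g : continuous (cfun f \+ cfun g).
Proof. by move=> x; apply: cvgD; exact: cfun_continuous. Qed.
Let oppP f : continuous (\- cfun f).
Proof. by move=> x; apply: cvgN; exact: cfun_continuous. Qed.
Let scaleP (a : R) f : continuous (fun x => a * cfun f x).
Proof. by move=> x; apply: cvgM; [exact: cvg_cst|exact: cfun_continuous]. Qed.

Definition cadd f g : C := mkcts (@addP f g).
Definition copp f : C := mkcts (@oppP f).
Definition cscale a f : C := mkcts (@scaleP a f).

Let addA : associative cadd.
Proof. by move=> f g h; apply: cspaceP => x; exact: addrA. Qed.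
Let addC : commutative cadd.
Proof. by move=> f g; apply: cspaceP => x; exact: addrC. Qed.
Let add0 : left_id zero cadd.
Proof. by move=> f; apply: cspaceP => x; exact: add0r. Qed.
Let addN : left_inverse zero copp cadd.
Proof. by move=> f; apply: cspaceP => x; exact: addNr. Qed.

HB.instance Definition _ := GRing.isZmodule.Build C addA addC add0 addN.

Let scaleA (a b : R) f : cscale a (cscale b f) = cscale (a * b) f.
Proof. by apply: cspaceP => x; exact: mulrA. Qed.
Let scale1 : left_id 1 cscale.
Proof. by move=> f; apply: cspaceP => x; exact: mul1r. Qed.
Let scaleDr : right_distributive cscale +%R.
Proof. by move=> a f g; apply: cspaceP => x; exact: mulrDr. Qed.
Let scaleDl f : {morph cscale^~ f : a b / a + b}.
Proof. by move=> a b; apply: cspaceP => x; exact: mulrDl. Qed.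

HB.instance Definition _ :=
  GRing.Zmodule_isLmodule.Build R C scaleA scale1 scaleDr scaleDl.

Lemma cfun_bounded f : exists M : R, forall x, `|cfun f x| <= M.
Proof.
have /compact_bounded[M [_ fM]] : compact (range (cfun f)).
  apply: continuous_compact cK; apply: continuous_subspaceT.
  exact: cfun_continuous.
exists (M + 1) => x; apply: (fM (M + 1)); first by rewrite ltrDl.
by exists x.
Qed.

Let cnorm f : R := sup_norm (cfun f).

Let cnormD f g : cnorm (f + g) <= cnorm f + cnorm g.
Proof.
have [M fM] := cfun_bounded f; have [N gN] := cfun_bounded g.
exact: sup_normD fM gN.
Qed.
Let cnormZ (a : R) f : cnorm (a *: f) = `|a| * cnorm f.
Proof. by have [M fM] := cfun_bounded f; exact: sup_normZ fM. Qed.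
Let cnorm0 f : cnorm f = 0 -> f = 0.
Proof.
have [M fM] := cfun_bounded f => f0.
by apply: cspaceP => x; exact: sup_norm0_eq0 fM f0 x.
Qed.

HB.instance Definition _ := Lmodule_isNormed.Build R C cnormD cnormZ cnorm0.

Lemma cspace_normE f : `|f| = sup_norm (cfun f). Proof. by []. Qed.

Lemma cfun_le_norm f x : `|cfun f x| <= `|f|.
Proof. by have [M fM] := cfun_bounded f; exact: le_sup_norm fM. Qed.

Lemma cspace_norm_le f (M : R) : 0 <= M -> (forall x, `|cfun f x| <= M) ->
  `|f| <= M.
Proof. exact: sup_norm_le. Qed.

Lemma cspace_complete (F : set_system C) :
  ProperFilter F -> cauchy F -> cvg F.
Proof.
move=> PF /cauchyP Fc.
have FE (e : R) : 0 < e -> exists g : C, \forall h \near F, `|g - h| < e.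
  by move=> e0; have [g Fg] := Fc e e0; exists g; move: Fg; rewrite -ball_normE.
pose l x : R := lim ((fun h : C => cfun h x) @ F).
have lP x : (fun h : C => cfun h x) @ F --> l x.
  apply: cauchy_cvg; apply: cauchy_exP => e e0.
  have [g Fg] := FE e e0; exists (cfun g x).
  apply: filterS Fg => h; rewrite -ball_normE /=; apply: le_lt_trans.
  exact: (cfun_le_norm (g - h) x).
have lE (e : R) : 0 < e -> \forall h \near F, forall x, `|l x - cfun h x| <= e.
  move=> e0; have e20 : 0 < e / 2 by rewrite divr_gt0.
  have [g Fg] := FE (e / 2) e20.
  have lg x : `|l x - cfun g x| <= e / 2.
    have ng : (fun h : C => `|cfun h x - cfun g x|) @ F --> `|l x - cfun g x|.
      by apply: cvg_norm; apply: cvgB; [exact: lP|exact: cvg_cst].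
    rewrite -(cvg_lim _ ng)//; apply: limr_le.
      by apply/cvg_ex; exists `|l x - cfun g x|.
    apply: filterS Fg => h gh; rewrite distrC (le_trans _ (ltW gh))//.
    exact: (cfun_le_norm (g - h) x).
  apply: filterS Fg => h gh x; rewrite [e]splitr.
  rewrite (le_trans (ler_distD (cfun g x) _ _))// lerD//.
  by rewrite (le_trans _ (ltW gh))// (cfun_le_norm (g - h) x).
have lc : continuous l.
  move=> x; apply/cvgrPdist_lt => e e0.
  have e30 : 0 < e / 3 by rewrite divr_gt0.
  have [h lh] := filter_ex (lE _ e30).
  have /cvgrPdist_lt/(_ _ e30) hx := @cfun_continuous h x.
  apply: filterS hx => y hxy.
  rewrite (_ : e = e / 3 + e / 3 + e / 3); last by field.
  rewrite (le_lt_trans (ler_distD (cfun h y) _ _))// ltr_leD//.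
    rewrite (le_lt_trans (ler_distD (cfun h x) _ _))// ler_ltD//.
  by rewrite distrC.
pose lC : C := mkcts lc; apply/cvg_ex; exists lC.
apply/cvgrPdist_le => e e0; apply: filterS (lE e e0) => h lh.
by apply: cspace_norm_le => [|x]; [exact: ltW|exact: lh].
Qed.

HB.instance Definition _ := Uniform_isComplete.Build C cspace_complete.

End cspace.

(** The composition map phi^* : C(L) -> C(K). *)
Definition composition_map (R : realType) (K L : topologicalType)
    (cK : compact [set: K]) (cL : compact [set: L]) (phi : continuousType K L)
    (f : cspace R cL) : cspace R cK :=
  (f : continuousType L R) \o phi.

Lemma composition_mapE (R : realType) (K L : topologicalType)
    (cK : compact [set: K]) (cL : compact [set: L]) (phi : continuousType K L)
    (f : cspace R cL) x :
  cfun (composition_map cK phi f) x = cfun f (phi x).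
Proof. by []. Qed.

Definition null_sequence (R : realType) : pred (nat -> R) :=
  [pred u : nat -> R | `[< u @ \oo --> (0 : R) >]].
Arguments null_sequence : clear implicits.

(** The Banach space c_0, with the sup norm. *)
Record c0 (R : realType) := C0Seq {
  c0_val :> nat -> R ;
  c0_valP : c0_val \in null_sequence R }.

Section c0.
Context (R : realType).

HB.instance Definition _ := [isSub for @c0_val R].
HB.instance Definition _ := [Choice of c0 R by <:].

Lemma null_sequence_submod : submod_closed (null_sequence R).
Proof.
split=> [|a u v]; rewrite !inE; first exact: cvg_cst.
move=> u0 v0; rewrite (_ : 0 = a * 0 + 0); last by rewrite mulr0 addr0.
by apply: (cvgD _ v0); apply: (cvgM _ u0); exact: cvg_cst.
Qed.

HB.instance Definition _ :=
  GRing.isSubmodClosed.Build R (nat -> R) (null_sequence R) null_sequence_submod.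
HB.instance Definition _ := [SubChoice_isSubLmodule of c0 R by <:].

Implicit Types u v : c0 R.

Lemma c0_cvg u : u @ \oo --> (0 : R).
Proof. by have := c0_valP u; rewrite inE. Qed.

Lemma c0_bounded u : exists M : R, forall n, `|u n| <= M.
Proof.
have : cvgn u by apply/cvg_ex; exists 0; exact: c0_cvg.
move=> /cvg_seq_bounded[M [_ uM]].
by exists (M + 1) => n; apply: (uM (M + 1)); rewrite ?ltrDl.
Qed.

Let c0norm u : R := sup_norm u.

Let c0normD u v : c0norm (u + v) <= c0norm u + c0norm v.
Proof.
have [M uM] := c0_bounded u; have [N vN] := c0_bounded v.
exact: sup_normD uM vN.
Qed.
Let c0normZ (a : R) u : c0norm (a *: u) = `|a| * c0norm u.
Proof. by have [M uM] := c0_bounded u; exact: sup_normZ uM. Qed.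
Let c0norm0 u : c0norm u = 0 -> u = 0.
Proof.
have [M uM] := c0_bounded u => u0.
by apply: val_inj; apply/funext => n; exact: sup_norm0_eq0 uM u0 n.
Qed.

HB.instance Definition _ :=
  Lmodule_isNormed.Build R (c0 R) c0normD c0normZ c0norm0.

Lemma c0_normE u : `|u| = sup_norm u. Proof. by []. Qed.

End c0.

Definition closed_subspace (R : realType) (X : normedModType R) (Y : set X) :=
  [/\ Y 0, (forall (a : R) x y, Y x -> Y y -> Y (a *: x + y)) & closed Y].

(** An operator defined on a subspace Y of X is represented by a function on X
    of which only the values on Y are relevant. *)
Definition bounded_operator_on (R : realType) (X W : normedModType R)
    (Y : set X) (T : X -> W) :=
  (forall (a : R) x y, Y x -> Y y -> T (a *: x + y) = a *: T x + T y) /\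
  (exists M : R, forall x, Y x -> `|T x| <= M * `|x|).

Definition operator_norm_on (R : realType) (X W : normedModType R)
    (Y : set X) (T : X -> W) : R :=
  sup [set `|T x| | x in [set x | Y x /\ `|x| <= 1]].

Definition c0_extension_property (R : realType) (X : completeNormedModType R)
    (lambda : R) (Y : set X) :=
  closed_subspace Y /\
  forall T : X -> c0 R, bounded_operator_on Y T ->
    exists T' : X -> c0 R,
      [/\ bounded_operator_on [set: X] T',
          (forall y, Y y -> T' y = T y) &
          operator_norm_on [set: X] T' <= lambda * operator_norm_on Y T].

Definition order_convex d (K : porderType d) (I : set K) :=
  forall x y, I x -> I y -> forall z, (x <= z <= y)%O -> I z.

Definition countable_union_of_intervals d (K : porderType d) (A : set K) :=
  exists I : nat -> set K, (forall n, order_convex (I n)) /\ A = \bigcup_n I n.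

(* Main.v *)
Require Import Defs.
From mathcomp Require Import all_boot all_order all_algebra.
From mathcomp Require Import lra.
From mathcomp Require Import all_classical all_reals all_analysis.

(** The theorem is an instance of Sobczyk's theorem: an operator into c_0
    defined on a subspace Y of a separable space extends to the whole space
    with at most twice its norm. The space C(K) itself is usually not
    separable, but it may be replaced by C(E), for a small closed set E in K.

    Call x in K a fibre endpoint when phi is constant on no [y, x] with y < x,
    or constant on no [x, y] with x < y, and let E be the set of these points;
    they are the ends of the maximal intervals on which phi is constant.
    - E is closed: if phi is constant on both [y, x] and [x, z], then no point
      of ]y, z[ is in E (closed_fibre_endpoint).
    - E is countable: each interval contained in a fibre contains at most one
      endpoint of each kind, and countably many such intervals cover K
      (countable_fibre_endpoint).
    - phi maps E onto L, because from any x one can move right, within its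
      fibre, to the last point y such that phi is constant on [x, y]
      (fibre_endpoint_surj).

    Let p f be the supremum of |f| over E. Then p is a seminorm below the norm
    of C(K), and by the third point it equals the norm on phi^* C(L). For this
    seminorm C(K) is separable (separable_on_countable_closed): the constants
    and the Urysohn functions that are 0 on the left of x and 1 on the right
    of y, for x < y in E, span a subspace that is p-dense. A continuous f is
    approximated by interpolating it along a chain of points of E; two
    successive points of the chain either have no point of E between them or
    are the ends of an interval of E on which f hardly varies.

    Sobczyk's theorem is proved for a seminorm p on a vector space V by the
    argument of Veech (sobczyk), with p scaled so as to bound the operator
    on Y. The coordinates t n of this operator extend to functionals x n on V,
    still bounded by p, by the Hahn-Banach theorem (hahn_banach). Every
    pointwise limit of the x n along a free ultrafilter is bounded by p and
    vanishes on Y, so x n gets pointwise close to the set of such functionals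
    (annihilator_approx). Separability then yields one sequence z n in this set
    for which x n - z n tends pointwise to 0 (annihilator_diagonal). The
    differences x n - z n are the coordinates of the extension, and they are
    bounded by 2 p; this is where the constant 2 comes from. *)

Set Implicit Arguments.
Unset Strict Implicit.
Unset Printing Implicit Defensive.

Import Order.TTheory GRing.Theory Num.Theory.
Import numFieldNormedType.Exports.

Local Open Scope classical_set_scope.
Local Open Scope ring_scope.

(** * The Hahn-Banach theorem for a seminorm *)

Section seminorms.
Context (R : realType) (V : lmodType R).
Implicit Types (p f g : V -> R) (Y : set V) (u v : V).

Definition seminorm p :=
  (forall u v, p (u + v) <= p u + p v) /\
  (forall a v, p (a *: v) = `|a| * p v).

Definition linear_subspace Y :=
  Y 0 /\ forall (a : R) u v, Y u -> Y v -> Y (a *: u + v).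

Definition scalar_on Y f :=
  forall (a : R) u v, Y u -> Y v -> f (a *: u + v) = a * f u + f v.

Lemma seminormZ_ge0 p M : seminorm p -> 0 <= M -> seminorm (fun v => M * p v).
Proof.
move=> [pD pZ] M0; split=> [u v|a v]; first by rewrite -mulrDr ler_wpM2l.
by rewrite pZ mulrCA.
Qed.

Lemma seminorm_ge0 p v : seminorm p -> 0 <= p v.
Proof.
move=> [pD pZ]; have := pD v ((-1) *: v).
rewrite scaleN1r subrr -[X in p X](scale0r (0 : V)) pZ normr0 mul0r.
by rewrite -scaleN1r pZ normrN1 mul1r; lra.
Qed.

Lemma scalar_on0 Y f : linear_subspace Y -> scalar_on Y f -> f 0 = 0.
Proof.
move=> [Y0 _] fY; have := fY 1 0 0 Y0 Y0.
by rewrite scaler0 addr0; lra.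
Qed.

End seminorms.

Section hahn_banach.
Context (R : realType) (V : lmodType R) (p : V -> R) (sp : seminorm p).
Context (Y : set V) (linY : linear_subspace Y).
Context (f : V -> R) (linf : scalar_on Y f) (fp : forall y, Y y -> f y <= p y).

Let G0 : set (V * R) := [set ur | Y ur.1 /\ ur.2 = f ur.1].

Let linear_graph (G : set (V * R)) :=
  forall (a : R) u r v s, G (u, r) -> G (v, s) -> G (a *: u + v, a * r + s).
Let dominated_graph (G : set (V * R)) := forall u r, G (u, r) -> r <= p u.

(* The graph of f is adjoined to G so that the empty chain has an upper bound. *)
Let extension (G : set (V * R)) :=
  linear_graph (G `|` G0) /\ dominated_graph (G `|` G0).

Let extension0 : extension set0.
Proof.
have [Y0 YD] := linY; rewrite /extension set0U; split=> [a u r v s|u r] [/= Yu ->].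
  by move=> [/= Yv ->]; split=> /=; [exact: YD|rewrite linf].
exact: fp.
Qed.

Let extension_bigcup (F : set (set (V * R))) :
  F `<=` extension -> total_on F subset -> extension (\bigcup_(X in F) X).
Proof.
move=> Fext Ftot.
have mem z : (\bigcup_(X in F) X `|` G0) z ->
    exists X, (F X \/ X = set0) /\ (X `|` G0) z.
  move=> [[X FX Xz]|G0z]; last by exists set0; split; right.
  by exists X; split; left.
have ext X : F X \/ X = set0 -> extension X by move=> [/Fext|->].
have sub X : F X \/ X = set0 -> X `|` G0 `<=` \bigcup_(X in F) X `|` G0.
  by move=> [FX|->]; apply: setSU => //; apply: bigcup_sup.
have tot X X' : F X \/ X = set0 -> F X' \/ X' = set0 -> X `<=` X' \/ X' `<=` X.
  by move=> [FX|->] [FX'|->]; [exact: Ftot|right|left|left].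
split=> [a u r v s /mem[X [FX Xu]] /mem[X' [FX' Xv]]|u r /mem[X [FX Xu]]].
  have [XX'|X'X] := tot _ _ FX FX'.
    by apply: (sub X') => //; apply: (ext _ FX').1 => //; exact: (setSU XX').
  by apply: (sub X) => //; apply: (ext _ FX).1 => //; exact: (setSU X'X).
exact: (ext _ FX).2 Xu.
Qed.

(** A value at v0 is admissible when it lies between every r - p (u - v0) and
    every p (w + v0) - s, for (u, r) and (w, s) in G; such values exist because
    r + s <= p (u + w) <= p (u - v0) + p (w + v0). *)
Let extension_step (G : set (V * R)) (v0 : V) :
  linear_graph G -> dominated_graph G -> G (0, 0) ->
  exists G', [/\ linear_graph G', dominated_graph G', G `<=` G' &
    exists r, G' (v0, r)].
Proof.
have [pD pZ] := sp; move=> linG domG G00.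
pose S := [set x | exists u r, G (u, r) /\ x = r - p (u - v0)].
have SP w s : G (w, s) -> ubound S (p (w + v0) - s).
  move=> Gw _ [u [r [Gu ->]]].
  have := domG _ _ (linG 1 _ _ _ _ Gu Gw); rewrite scale1r mul1r.
  have := pD (u - v0) (w + v0).
  by rewrite addrACA [- v0 + v0]addNr addr0; lra.
have S0 : S !=set0 by exists (0 - p (0 - v0)), 0, 0.
pose alpha := sup S.
have alpha_le w s : G (w, s) -> alpha <= p (w + v0) - s.
  by move=> Gw; apply: ge_sup => //; exact: SP.
have le_alpha u r : G (u, r) -> r - p (u - v0) <= alpha.
  by move=> Gu; apply: ub_le_sup; [eexists; exact: (SP _ _ G00)|exists u, r].
have ppZ t v : 0 < t -> t * p v = p (t *: v).
  by move=> t0; rewrite pZ gtr0_norm.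
have GZ (a : R) u r : G (u, r) -> G (a *: u, a * r).
  by move=> Gu; have := linG a _ _ _ _ Gu G00; rewrite !addr0.
exists [set ur | exists u r t, G (u, r) /\ ur = (u + t *: v0, r + t * alpha)].
split.
- move=> a _ _ _ _ [u [r [t [Gu [-> ->]]]]] [w [s [t' [Gw [-> ->]]]]].
  exists (a *: u + w), (a * r + s), (a * t + t'); split; first exact: linG.
  congr pair; last by lra.
  by rewrite scalerDr scalerA scalerDl addrACA.
- move=> _ _ [u [r [t [Gu [-> ->]]]]].
  have [t0|t0|->] := ltgtP t 0; last first.
  + by rewrite scale0r mul0r !addr0; exact: domG.
  + have := alpha_le _ _ (GZ t^-1 _ _ Gu).
    rewrite -(ler_pM2l t0) mulrBr mulVKf ?gt_eqF//.
    rewrite ppZ// scalerDr scalerA mulfV ?gt_eqF// scale1r; lra.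
  + have nt0 : 0 < - t by rewrite oppr_gt0.
    have := le_alpha _ _ (GZ (- t)^-1 _ _ Gu).
    rewrite -(ler_pM2l nt0) mulrBr mulVKf ?gt_eqF//.
    rewrite ppZ// scalerBr scalerA mulfV ?gt_eqF// scale1r scaleNr opprK.
    lra.
- by move=> [u r] Gu; exists u, r, 0; split; rewrite // scale0r mul0r !addr0.
- by exists alpha, 0, 0, 1; rewrite scale1r mul1r !add0r.
Qed.

(** An extension of f is handled through its graph, so that Zorn's lemma for
    unions of chains of sets applies. Domination by p makes a linear graph
    single-valued, since (0, r) can belong to it only if r <= p 0 = 0. *)
Theorem hahn_banach : exists g : V -> R,
  [/\ scalar g, (forall y, Y y -> g y = f y) & forall v, `|g v| <= p v].
Proof.
have [pD pZ] := sp.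
have [A [[linG domG] Amax]] := Zorn_bigcup extension_bigcup.
set G := A `|` G0 in linG domG.
have G00 : G (0, 0).
  by right; split; [case: linY|rewrite /= (scalar_on0 linY linf)].
have total v : exists r, G (v, r).
  apply: contrapT => vG.
  have [G' [linG' domG' GG' [r G'v]]] := extension_step v linG domG G00.
  have G'G0 : G' `|` G0 = G'
    by apply/seteqP; split=> z; [case=> // G0z; apply: GG'; right|left].
  apply: (Amax G'); last by rewrite /extension G'G0.
  split; first by move=> z Az; apply: GG'; left.
  by move=> /(_ _ G'v) Av; apply: vG; exists r; left.
have unique v r s : G (v, r) -> G (v, s) -> r = s.
  have le r' s' : G (v, r') -> G (v, s') -> s' <= r'.
    move=> Gr Gs; have := domG _ _ (linG (-1) _ _ _ _ Gr Gs).
    rewrite scaleN1r addNr -[X in p X](scale0r (0 : V)) pZ normr0 mul0r.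
    by lra.
  by move=> Gr Gs; apply/eqP; rewrite eq_le !le.
pose g v := projT1 (cid (total v)).
have gP v : G (v, g v) by rewrite /g; case: cid.
have glin : scalar g.
  by move=> a u v; apply: (unique (a *: u + v)) => //; exact: linG.
exists g; split=> // [y Yy|v].
  by apply: (unique y) => //; right.
rewrite ler_norml domG// andbT lerNl.
have := domG _ _ (linG (-1) _ _ _ _ (gP v) G00).
by rewrite !addr0 pZ normrN1; lra.
Qed.

End hahn_banach.

(** * Sobczyk's theorem for a separable seminorm *)

Section sobczyk.
Context (R : realType) (V : lmodType R) (p : V -> R) (sp : seminorm p).
Implicit Types (x t d : nat -> V -> R) (h : nat -> V) (Y H : set V).

Lemma ultra_bounded_cvg (U : set_system nat) (u : nat -> R) (M : R) :
  UltraFilter U -> (forall n, `|u n| <= M) ->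
  exists2 l : R, `|l| <= M & u @ U --> l.
Proof.
move=> UU uM; have PU : ProperFilter U by exact: ultra_proper.
have /(_ (u @ U) _)[|l [lM ul]] := @segment_compact R (- M) M.
  by apply: (@filterE _ U) => n /=; rewrite in_itv /= -ler_norml.
exists l => [|B lB]; first by move: lM; rewrite /= in_itv /= -ler_norml.
have [//|UB] := in_ultra_setVsetC (u @^-1` B) UU.
by have [r []] := ul (~` B) B UB lB.
Qed.

Definition dominated_annihilator Y : set (V -> R) :=
  [set z | [/\ scalar z, (forall v, `|z v| <= p v) & forall y, Y y -> z y = 0]].

(** If approximation failed for infinitely many n, a limit of the x n along an
    ultrafilter carried by the bad indices would lie in the annihilator of Y,
    because x n tends to 0 on Y, and it would approximate some bad x n. *)
Lemma annihilator_approx Y x h (k : nat) (e : R) :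
  (forall n, scalar (x n)) -> (forall n v, `|x n v| <= p v) ->
  (forall y, Y y -> x ^~ y @ \oo --> (0 : R)) -> 0 < e ->
  \forall n \near \oo, exists2 z, dominated_annihilator Y z &
    forall j, (j < k)%N -> `|x n (h j) - z (h j)| <= e.
Proof.
move=> xlin xp xY e0.
pose good n := exists2 z, dominated_annihilator Y z &
  forall j, (j < k)%N -> `|x n (h j) - z (h j)| <= e.
suff [N NP] : exists N, forall n, (N <= n)%N -> good n by exists N.
apply: contrapT => bad.
have sel N : exists n, (N <= n)%N /\ ~ good n.
  apply: contrapT => sel; apply: bad; exists N => n Nn.
  by apply: contrapT => ngood; apply: sel; exists n.
pose s N := projT1 (cid (sel N)).
have sP N : (N <= s N)%N /\ ~ good (s N) by rewrite /s; case: cid.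
have [U [UU subU]] := @ultraFilterLemma _ \oo _.
have PU : ProperFilter U by exact: ultra_proper.
have lim v : exists l : R, `|l| <= p v /\ (fun N => x (s N) v) @ U --> l.
  by have [l] := ultra_bounded_cvg UU (fun N => xp (s N) v); exists l.
pose z v := projT1 (cid (lim v)).
have zP v : `|z v| <= p v /\ (fun N => x (s N) v) @ U --> z v.
  by rewrite /z; case: cid.
have ulim (w : nat -> R) (a b : R) : w @ U --> a -> w @ U --> b -> a = b.
  by move=> wa wb; rewrite -(cvg_lim (@Rhausdorff R) wa); exact: cvg_lim wb.
have Yz : dominated_annihilator Y z.
  split=> [a u v|v|y Yy]; last 2 first.
  - by have [] := zP v.
  - apply: (ulim (fun N => x (s N) y)); first by have [] := zP y.
    have sy : (fun N => x (s N) y) @ \oo --> (0 : R).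
      apply/cvgrPdist_lt => d d0.
      have /cvgrPdist_lt/(_ _ d0)[N _ NP] := xY _ Yy.
      by exists N => // n /= Nn; apply: NP => /=; apply: leq_trans Nn (sP n).1.
    by apply: cvg_trans sy; apply: cvg_app; exact: subU.
  - apply: (ulim (fun N => x (s N) (a *: u + v))); first by have [] := zP (a *: u + v).
    rewrite (_ : (fun _ => _) = (fun N => a * x (s N) u + x (s N) v)); last first.
      by apply/funext => N; rewrite xlin.
    by apply: cvgD; [apply: cvgM; [exact: cvg_cst|exact: (zP u).2]|exact: (zP v).2].
have [N NP] : exists N, forall j, (j < k)%N -> `|x (s N) (h j) - z (h j)| <= e.
  suff /(@filter_ex _ _ PU)[N NP] : U [set N | forall j, (j < k)%N ->
      `|x (s N) (h j) - z (h j)| <= e] by exists N.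
  elim: (k) => [|k' IH]; first by apply: filterE => N j; rewrite ltn0.
  have /cvgrPdist_le/(_ _ e0) kz := (zP (h k')).2.
  apply: filterS2 IH kz => N IH kz j.
  by rewrite ltnS leq_eqVlt => /predU1P[->|/IH//]; rewrite distrC.
by apply: (sP N).2; exists z.
Qed.

(** A diagonal choice: for every k, all large n admit an approximation of x n
    within 1 / (k + 1) at the first k points of h. *)
Lemma annihilator_diagonal Y x h :
  (forall n, scalar (x n)) -> (forall n v, `|x n v| <= p v) ->
  (forall y, Y y -> x ^~ y @ \oo --> (0 : R)) ->
  exists z, (forall n, dominated_annihilator Y (z n)) /\
    forall j, (fun n => x n (h j) - z n (h j)) @ \oo --> (0 : R).
Proof.
move=> xlin xp xY.
pose close n k (z : V -> R) := dominated_annihilator Y z /\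
  forall j, (j < k)%N -> `|x n (h j) - z (h j)| <= k.+1%:R^-1.
(* For each n the largest admissible k <= n is used, and it tends to infinity
   with n; the bound k <= n only ensures that a largest one exists. *)
pose P n k := `[< exists z, close n k z >] && (k <= n)%N.
have P0 n : exists k, P n k.
  exists 0%N; rewrite /P leq0n andbT; apply/asboolP; exists (fun=> 0); split=> //.
  split=> [a u v|v|//]; first by rewrite mulr0 addr0.
  by rewrite normr0 seminorm_ge0.
have Pn n k : P n k -> (k <= n)%N by move=> /andP[].
have Pclose n : exists z, close n (ex_maxn (P0 n) (Pn n)) z.
  by case: ex_maxnP => k /andP[/asboolP].
pose z n := projT1 (cid (Pclose n)).
have zP n : close n (ex_maxn (P0 n) (Pn n)) (z n) by rewrite /z; case: cid.
exists z; split=> [n|j]; first by have [] := zP n.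
apply/cvgrPdist_le => e e0.
have [k0 k0e] : exists k0, k0.+1%:R^-1 <= e.
  have := @cvg_harmonic R; move/cvgrPdist_le => /(_ _ e0)[N _ /(_ N (leqnn N))].
  by rewrite sub0r normrN ger0_norm ?invr_ge0//; exists N.
pose k1 := maxn k0 j.+1.
have := annihilator_approx h k1 xlin xp xY (_ : 0 < k1.+1%:R^-1).
rewrite invr_gt0 ltr0n => /(_ isT); apply: filterS2 (nbhs_infty_ge k1) => n k1n.
move=> [z0 z0Y z0x]; rewrite sub0r normrN; have [_] := zP n.
case: ex_maxnP => k _ kmax; have k1k : (k1 <= k)%N.
  by apply: kmax; rewrite /P k1n andbT; apply/asboolP; exists z0.
move=> /(_ j); rewrite (leq_trans _ k1k) ?leq_maxr// => /(_ isT) /le_trans; apply.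
apply: le_trans k0e; rewrite lef_pV2 ?posrE ?ltr0n// ler_nat ltnS.
by rewrite (leq_trans _ k1k)// leq_maxl.
Qed.

(** Separability enters as a countable set H such that every subspace
    containing H is p-dense. The pointwise convergence of x n - z n to 0 passes
    from H to its span by linearity, and from there to V because all
    these functionals are bounded by 2 p. *)
Theorem sobczyk Y H t :
  linear_subspace Y -> countable H ->
  (forall S, linear_subspace S -> H `<=` S ->
    forall v (e : R), 0 < e -> exists2 g, S g & p (v - g) <= e) ->
  (forall n, scalar_on Y (t n)) -> (forall n y, Y y -> `|t n y| <= p y) ->
  (forall y, Y y -> t ^~ y @ \oo --> (0 : R)) ->
  exists d, [/\ forall n, scalar (d n),
    (forall n y, Y y -> d n y = t n y),
    (forall n v, `|d n v| <= 2 * p v) &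
    forall v, d ^~ v @ \oo --> (0 : R)].
Proof.
move=> linY cH dense tlin tp t0.
have ext n : exists g : V -> R,
    [/\ scalar g, (forall y, Y y -> g y = t n y) & forall v, `|g v| <= p v].
  apply: hahn_banach => // y Yy.
  by apply: le_trans (tp n _ Yy); exact: ler_norm.
pose x n := projT1 (cid (ext n)).
have xP n : [/\ scalar (x n), (forall y, Y y -> x n y = t n y) &
    forall v, `|x n v| <= p v] by rewrite /x; case: cid.
have [h Hh] : exists h, H `<=` range h.
  have /pfcard_geP[->|[h]] := cH.
  - by exists (fun=> 0).
  - by exists h => v /(@surj _ _ _ _ h)[n _ <-]; exists n.
have [|||z [zY zh]] := @annihilator_diagonal Y x h.
- by move=> n; have [] := xP n.
- by move=> n; have [] := xP n.
- move=> y Yy; rewrite (_ : x ^~ y = t ^~ y); first exact: t0.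
  by apply/funext => n; have [_ ->] := xP n.
pose d n v := x n v - z n v.
have dlin n : scalar (d n).
  have [xlin _ _] := xP n; have [zlin _ _] := zY n.
  by move=> a u v; rewrite /d xlin zlin; lra.
have dp n v : `|d n v| <= 2 * p v.
  have [_ _ xp] := xP n; have [_ zp _] := zY n.
  by apply: le_trans (ler_normB _ _) _; have := xp v; have := zp v; lra.
exists d; split=> // [n y Yy|v].
  by have [_ xt _] := xP n; have [_ _ z0] := zY n; rewrite /d xt// z0// subr0.
have linS : linear_subspace [set v | d ^~ v @ \oo --> (0 : R)].
  split=> [|a u w du dw] /=.
    rewrite (_ : (fun _ => _) = (fun=> 0)); first exact: cvg_cst.
    by apply/funext => n; have := dlin n 1 0 0; rewrite scaler0 addr0; lra.
  rewrite (_ : (fun _ => _) = (fun n => a * d n u + d n w)); last first.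
    by apply/funext => n; rewrite dlin.
  rewrite [X in _ --> X](_ : _ = a * 0 + 0); last by rewrite mulr0 addr0.
  by apply: cvgD dw; apply: cvgM du; exact: cvg_cst.
have HS : H `<=` [set v | d ^~ v @ \oo --> (0 : R)]
  by move=> _ /Hh[j _ <-]; exact: (zh j).
apply/cvgrPdist_le => e e0; have e40 : 0 < e / 4 by lra.
have [g /cvgrPdist_le/(_ _ e40) dg vg] := dense _ linS HS v _ e40.
apply: filterS dg => n; rewrite !sub0r !normrN => dg.
have -> : d n v = d n (v - g) + d n g.
  by rewrite -[in LHS](subrK g v) -[v - g]scale1r dlin mul1r scale1r.
by apply: le_trans (ler_normD _ _) _; have := dp n (v - g); lra.
Qed.

End sobczyk.

(** * Separability of C(K) on countable closed subsets of a compact line *)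

(** The final segments of A for a closed total preorder have the finite
    intersection property. Taking for r an order or its converse gives the
    largest and the least element of a compact set. *)
Lemma compact_extremum (T : topologicalType) (r : T -> T -> Prop) (A : set T) :
  compact A -> A !=set0 -> (forall a, closed [set b | r a b]) ->
  (forall a b, r a b \/ r b a) -> (forall a b c, r a b -> r b c -> r a c) ->
  exists2 s, A s & forall a, A a -> r a s.
Proof.
move=> cA [a0 Aa0] clr tot tr; have refl a : r a a by case: (tot a a).
pose F := filter_from A (fun a => A `&` [set b | r a b]).
have PF : ProperFilter F.
  apply: filter_from_proper; last by move=> a Aa; exists a; split.
  apply: filter_from_filter; first by exists a0.
  move=> a b Aa Ab; have [rab|rba] := tot a b.
    by exists b => // c [Ac rbc]; split; split=> //=; exact: tr rab rbc.
  by exists a => // c [Ac rac]; split; split=> //=; exact: tr rba rac.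
have [|s [As Fs]] := cA F PF; first by exists a0 => // b [].
exists s => // a Aa; apply: (clr a) => B sB.
have FA : F (A `&` [set b | r a b]) by exists a.
by have [c [[_ rac] Bc]] := Fs _ _ FA sB; exists c.
Qed.

Section compact_line.
Context (d : Order.disp_t) (K : orderTopologicalType d).
Implicit Types (x y z : K) (A E : set K).

Lemma compact_max A : compact A -> A !=set0 ->
  exists2 s, A s & forall a, A a -> (a <= s)%O.
Proof.
move=> cA A0; apply: (@compact_extremum _ (fun a b => (a <= b)%O)) => //.
- by move=> a; have := @rray_closed _ _ a; rewrite set_itvE.
- by move=> a b; exact/orP/le_total.
- by move=> a b c; exact: le_trans.
Qed.

Lemma compact_min A : compact A -> A !=set0 ->
  exists2 s, A s & forall a, A a -> (s <= a)%O.
Proof.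
move=> cA A0; apply: (@compact_extremum _ (fun a b => (b <= a)%O)) => //.
- by move=> a; have := @lray_closed _ _ a; rewrite set_itvE.
- by move=> a b; exact/orP/le_total.
- by move=> a b c ba cb; exact: le_trans cb ba.
Qed.

Lemma nbhs_order_convex x (U : set K) : nbhs x U ->
  exists I : set K, [/\ nbhs x I, order_convex I & I `<=` U].
Proof.
rewrite itv_nbhsE => -[i [oi xi] iU]; exists [set` i]; split=> //.
  by exists i.
move=> a b ia ib z /andP[az zb].
case: i {oi xi iU} ia ib => l r /andP[la _] /andP[_ br]; apply/andP; split.
  by apply: le_trans la _; rewrite bnd_simp.
by apply: le_trans br; rewrite bnd_simp.
Qed.

Context (R : realType) (cK : compact [set: K]).
Local Notation C := (cspace R cK).
Implicit Types (f g h : C) (S H : set C).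

Lemma order_urysohn x y : (x < y)%O -> exists h,
  [/\ forall z, 0 <= cfun h z <= 1, forall z, (z <= x)%O -> cfun h z = 0 &
      forall z, (y <= z)%O -> cfun h z = 1].
Proof.
move=> xy; pose A := `]-oo, x]%classic; pose B := `[y, +oo[%classic.
have sepAB : uniform_separator A B.
  apply: (iffLR (@normal_separatorP R K)).
  - exact: compact_normal order_hausdorff cK.
  - exact: lray_closed.
  - exact: rray_closed.
  - apply/seteqP; split=> // z; rewrite /A /B !set_itvE => -[/= zx yz].
    by have := le_lt_trans (le_trans yz zx) xy; rewrite ltxx.
exists (mkcts (@Urysohn_continuous K R A B)); split=> z.
- have /(_ (Urysohn A B z)) := @Urysohn_range K R A B.
  by rewrite /= in_itv /=; apply; exists z.
- by move=> zx; apply: (Urysohn_sub0 sepAB); exists z; rewrite // /A set_itvE.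
- by move=> yz; apply: (Urysohn_sub1 sepAB); exists z; rewrite // /B set_itvE.
Qed.

(** The approximant is built from left to right: s is reached when some g in S
    approximates f on the part of E up to s and is constant, equal to f s,
    on the part of E from s on. Adding (f u - f s) times the Urysohn function of
    s < u reaches u, provided that f varies little on E between s and u. The
    supremum of the reached points is itself reached, and it is the last point
    M of E: otherwise let t be the infimum of the points of E on its right; if
    t is strictly to the right it is reached by a jump, and if not then points
    of E just to the right are reached by continuity of f. *)
Lemma separable_on_countable_closed E : closed E -> countable E ->
  exists H, countable H /\ forall S, linear_subspace S -> H `<=` S ->
    forall f (e : R), 0 < e ->
    exists2 g, S g & forall x, E x -> `|cfun f x - cfun g x| <= e.
Proof.
move=> clE cE.
have [ury uryP] : exists ury : K * K -> C, forall xy, (xy.1 < xy.2)%O ->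
    [/\ forall z, 0 <= cfun (ury xy) z <= 1,
        forall z, (z <= xy.1)%O -> cfun (ury xy) z = 0 &
        forall z, (xy.2 <= z)%O -> cfun (ury xy) z = 1].
  have ex xy : exists h : C, (xy.1 < xy.2)%O ->
      [/\ forall z, 0 <= cfun h z <= 1, forall z, (z <= xy.1)%O -> cfun h z = 0 &
          forall z, (xy.2 <= z)%O -> cfun h z = 1].
    have [/order_urysohn[h hP]|] := boolP (xy.1 < xy.2)%O; first by exists h.
    by exists 0.
  by exists (fun xy => projT1 (cid (ex xy))) => xy; case: cid.
pose one : C := cst 1.
exists ((ury @` (E `*` E)) `|` [set one]); split.
  rewrite -bigcup2E; apply: bigcup_countable => // -[|[|i]] _ //=.
  by apply: card_le_trans (card_image_le _ _) _; exact: countableX.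
move=> S [S0 SD] HS f e e0.
have Sury x y : E x -> E y -> S (ury (x, y)).
  by move=> Ex Ey; apply: HS; left; exists (x, y).
have Sone : S one by apply: HS; right.
have cE' : compact E by exact: subclosed_compact cK _.
have [->|/set0P E0] := eqVneq E set0; first by exists 0.
have [m Em mP] := compact_min cE' E0; have [M EM MP] := compact_max cE' E0.
pose reach s := E s /\ exists g, [/\ S g,
  forall x, E x -> (x <= s)%O -> `|cfun f x - cfun g x| <= e &
  forall x, E x -> (s <= x)%O -> cfun g x = cfun f s].
have reach_m : reach m.
  split=> //; exists (cfun f m *: one + 0); split.
  - exact: SD.
  - move=> x Ex xm; have -> : x = m by apply/eqP; rewrite eq_le xm mP.
    change (`|cfun f m - (cfun f m * 1 + 0)| <= e).
    by rewrite mulr1 addr0 subrr normr0 ltW.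
  - move=> x _ _; change (cfun f m * 1 + 0 = cfun f m).
    by rewrite mulr1 addr0.
have reach_step s u : reach s -> E u -> (s <= u)%O ->
    (forall x, E x -> (s < x)%O -> (x < u)%O ->
      `|cfun f x - cfun f s| <= e /\ `|cfun f x - cfun f u| <= e) -> reach u.
  move=> rs Eu; rewrite le_eqVlt => /predU1P[<-//|su] osc.
  have [Es [g [Sg gf gs]]] := rs.
  have [h01 h0 h1] := uryP (s, u) su.
  split=> //; exists ((cfun f u - cfun f s) *: ury (s, u) + g); split.
  - by apply: SD => //; exact: Sury.
  - move=> x Ex xu.
    change (`|cfun f x - ((cfun f u - cfun f s) * cfun (ury (s, u)) x + cfun g x)| <= e).
    have [xs|sx] := leP x s; first by rewrite h0// mulr0 add0r; exact: gf.
    rewrite gs//; last exact: ltW.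
    move: xu; rewrite le_eqVlt => /predU1P[->|xu].
      by rewrite (h1 u (lexx u)) mulr1 subrK subrr normr0 ltW.
    (* The approximant at x is a convex combination of f s and f u. *)
    have [] := osc _ Ex sx xu; have /andP[] := h01 x.
    rewrite !ler_norml => ? ? /andP[? ?] /andP[? ?]; nra.
  - move=> x Ex ux.
    change ((cfun f u - cfun f s) * cfun (ury (s, u)) x + cfun g x = cfun f u).
    by rewrite h1// gs// ?mulr1 ?subrK//; exact: ltW (lt_le_trans su ux).
have local s : exists I : set K, [/\ nbhs s I, order_convex I &
    forall x, I x -> `|cfun f s - cfun f x| <= e / 2].
  have e20 : 0 < e / 2 by lra.
  have /cvgrPdist_le/(_ _ e20) := @cfun_continuous _ _ cK f s.
  by move=> /nbhs_order_convex[I [sI cI If]]; exists I; split.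
have reach_near s u v : reach u -> E v -> (u <= v)%O ->
    (exists I : set K, [/\ order_convex I, I u, I v &
      forall x, I x -> `|cfun f s - cfun f x| <= e / 2]) -> reach v.
  move=> ru Ev uv [I [cI Iu Iv If]]; apply: (reach_step u) => // x Ex ux xv.
  have Ix : I x by apply: (cI u v) => //; rewrite !ltW.
  by have := If _ Iu; have := If _ Iv; have := If _ Ix; rewrite !ler_norml; lra.
have sub_compact A : A `<=` E -> compact (closure A) /\ closure A `<=` E.
  move=> AE; split; first by apply: subclosed_compact cK _ => //; exact: closed_closure.
  by move=> x /(closure_subset AE); exact: clE.
have [s [rs ns]] : exists s, reach s /\ forall u, reach u -> (u <= s)%O.
  have [|cR RE] := sub_compact [set s | reach s]; first by move=> s [].
  have [|s Rs smax] := compact_max cR.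
    by exists m; exact: subset_closure.
  exists s; split; last by move=> u ru; apply: smax; exact: subset_closure.
  have [I [sI cI If]] := local s; have [r [rr Ir]] := Rs _ sI.
  apply: (reach_near s r) => //; first exact: RE.
    by apply: smax; exact: subset_closure.
  by exists I; split=> //; exact: nbhs_singleton.
suff sM : s = M.
  by have [_ [g [Sg gf _]]] := rs; exists g => // x Ex; apply: gf => //; rewrite sM MP.
apply: contrapT => sM.
have sltM : (s < M)%O by rewrite lt_neqAle MP ?andbT; [exact/eqP|case: rs].
have [|cA AE] := sub_compact [set u | E u /\ (s < u)%O]; first by move=> u [].
have [|t At tmin] := compact_min cA; first by exists M; exact: subset_closure.
have st : (s <= t)%O.
  have : closure [set u | E u /\ (s < u)%O] `<=` `[s, +oo[%classic.
    apply: (subset_trans (closure_subset _) (@rray_closed _ _ s)) => u [_ su].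
    by rewrite set_itvE /= ltW.
  by move=> /(_ _ At); rewrite set_itvE.
have : reach t.
  apply: (reach_step s) => //; first exact: AE.
  move=> x Ex sx xt; have : (t <= x)%O by apply: tmin; exact: subset_closure.
  by rewrite leNgt xt.
move=> rt; have ts : t = s by apply/eqP; rewrite eq_le st ns.
have [I [sI cI If]] := local s.
have tI : nbhs t I by rewrite ts.
have [u [[Eu su] Iu]] := At I tI.
have : reach u.
  apply: (reach_near s s) => //; first exact: ltW.
  by exists I; split=> //; exact: nbhs_singleton.
by move=> /ns; rewrite leNgt su.
Qed.
End compact_line.

(** * The endpoints of the maximal intervals of constancy *)

Section fibre_endpoints.
Context (d : Order.disp_t) (K : orderTopologicalType d) (L : topologicalType).
Context (phi : K -> L).
Implicit Types x y z : K.

(** The value at x serves as reference, so this is meant for x <= y. *)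
Definition constant_between x y :=
  forall z, (x <= z)%O -> (z <= y)%O -> phi z = phi x.

Definition left_endpoint x := forall y, (y < x)%O -> ~ constant_between y x.
Definition right_endpoint x := forall y, (x < y)%O -> ~ constant_between x y.
Definition fibre_endpoint : set K := [set x | left_endpoint x \/ right_endpoint x].

Lemma constant_between_sub x y x' y' : constant_between x y ->
  (x <= x')%O -> (x' <= y')%O -> (y' <= y)%O -> constant_between x' y'.
Proof.
move=> cxy xx' x'y' y'y z x'z zy'.
rewrite (cxy z (le_trans xx' x'z) (le_trans zy' y'y)).
by rewrite (cxy x' xx' (le_trans x'y' y'y)).
Qed.

Lemma constant_between_cat x y z : (x <= y)%O ->
  constant_between x y -> constant_between y z -> constant_between x z.
Proof.
move=> xy cxy cyz w xw wz; have [wy|yw] := leP w y; first exact: cxy.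
by rewrite (cyz w (ltW yw) wz) (cxy y).
Qed.

Lemma closed_fibre_endpoint : closed fibre_endpoint.
Proof.
move=> x clx; apply: contrapT => nx.
have [y [yx cyx]] : exists y, (y < x)%O /\ constant_between y x.
  apply: contrapT => ny; apply: nx; left => y yx cyx.
  by apply: ny; exists y.
have [z [xz cxz]] : exists z, (x < z)%O /\ constant_between x z.
  apply: contrapT => nz; apply: nx; right => z xz cxz.
  by apply: nz; exists z.
have cyz := constant_between_cat (ltW yx) cyx cxz.
have xyz : nbhs x `]y, z[%classic.
  apply: open_nbhs_nbhs; split; first exact: itv_open.
  by rewrite /= in_itv /= yx xz.
have [w [Ew]] := clx _ xyz; rewrite /= in_itv /= => /andP[yw wz].
case: Ew => [/(_ _ yw)|/(_ _ wz)]; apply.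
  by apply: constant_between_sub cyz _ _ _; rewrite // ltW.
by apply: constant_between_sub cyz _ _ _; rewrite // ltW.
Qed.

(** Of two points in one interval of a fibre, the right one is not a left
    endpoint and the left one is not a right endpoint. *)
Lemma countable_fibre_endpoint : countable [set: L] ->
  (forall p, countable_union_of_intervals (phi @^-1` [set p])) ->
  countable fibre_endpoint.
Proof.
move=> cL intervals.
pose I p := projT1 (cid (intervals p)).
have IP p : (forall n, order_convex (I p n)) /\ phi @^-1` [set p] = \bigcup_n I p n.
  by rewrite /I; case: cid.
have Iphi p n x : I p n x -> phi x = p.
  by move=> Ix; have [_ /seteqP[_ sub]] := IP p; apply: sub; exists n.
have Iconst p n x y : I p n x -> I p n y -> constant_between x y.
  move=> Ix Iy z xz zy; rewrite (Iphi _ _ _ Ix); apply: (Iphi p n).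
  by have [cI _] := IP p; apply: (cI n x y); rewrite // xz zy.
have one (A : set K) : (forall x y, A x -> A y -> (x < y)%O -> False) -> countable A.
  move=> A1; have [->|/set0P[a Aa]] := eqVneq A set0; first exact: countable0.
  apply: card_le_trans (countable1 a); apply: subset_card_le => x Ax.
  by have [/A1|/A1|//] := ltgtP x a; case.
pose A p n b := I p n `&` (if b then left_endpoint else right_endpoint).
have cA : countable (\bigcup_p \bigcup_n (A p n true `|` A p n false)).
  apply: bigcup_countable => // p _; apply: bigcup_countable => // n _.
  rewrite -bigcup2E; apply: bigcup_countable => // -[|[|i]] _ //=; apply: one.
    by move=> x y [Ix _] [Iy ly] xy; apply: (ly x) => //; exact: Iconst Ix Iy.
  by move=> x y [Ix rx] [Iy _] xy; apply: (rx y) => //; exact: Iconst Ix Iy.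
apply: card_le_trans cA; apply: subset_card_le => x Ex; exists (phi x) => //.
have [_ /seteqP[/(_ x erefl)[n _ Ix] _]] := IP (phi x).
by exists n => //; case: Ex => [lx|rx]; [left|right].
Qed.

(** The set A of the points y such that phi is constant on [x, y] is closed,
    and its maximum is a right endpoint in the fibre of x. *)
Lemma fibre_endpoint_surj : compact [set: K] -> hausdorff_space L ->
  continuous phi -> forall x, exists2 y, fibre_endpoint y & phi y = phi x.
Proof.
move=> cK hL cphi x; pose A := [set y | (x <= y)%O /\ constant_between x y].
have Ax : A x by split=> // z xz zx; congr phi; apply/eqP; rewrite eq_le xz zx.
have clA : closed A.
  have clf : closed [set y | (x <= y)%O /\ phi y = phi x].
    apply: closedI; first by have := @rray_closed _ _ x; rewrite set_itvE.
    apply: (closed_comp (f := phi) (D := [set phi x])) => [y _|]; first exact: cphi.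
    exact: accessible_closed_set1 (hausdorff_accessible hL) _.
  have Af : A `<=` [set y | (x <= y)%O /\ phi y = phi x].
    by move=> y [xy cxy]; split => //; exact: cxy.
  move=> s As; have [xs phis] := clf _ (closure_subset Af As); split=> // z xz.
  rewrite le_eqVlt => /predU1P[->//|zs].
  have sz : nbhs s `]z, +oo[%classic.
    by apply: open_nbhs_nbhs; split; [exact: rray_open|rewrite /= in_itv /= zs].
  have [y [[xy cxy]]] := As _ sz; rewrite /= in_itv /= andbT => /ltW.
  exact: cxy.
have [||s [xs cxs] smax] := @compact_max _ _ A.
- exact: subclosed_compact cK _.
- by exists x.
exists s; last by apply: cxs.
right=> y sy csy; have : (y <= s)%O.
  by apply: smax; split; [exact: le_trans xs (ltW sy)|exact: constant_between_cat csy].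
by rewrite leNgt sy.
Qed.

End fibre_endpoints.

(** * Operator norms and the range of the composition map *)

Section operator_norm.
Context (R : realType) (X W : normedModType R) (Y : set X) (T : X -> W).

Lemma has_ubound_operator_norm : bounded_operator_on Y T ->
  has_ubound [set `|T x| | x in [set x | Y x /\ `|x| <= 1]].
Proof.
move=> [_ [M TM]]; exists `|M| => _ [x [Yx x1] <-].
apply: le_trans (TM _ Yx) _; rewrite (le_trans (ler_norm _))// normrM normr_id.
by rewrite -[leRHS]mulr1 ler_wpM2l.
Qed.

Lemma le_operator_norm : linear_subspace Y -> bounded_operator_on Y T ->
  forall y, Y y -> `|T y| <= operator_norm_on Y T * `|y|.
Proof.
move=> [Y0 YD] bT y Yy; have [Tlin _] := bT.
have T0 : T 0 = 0.
  by have := Tlin (-1) 0 0 Y0 Y0; rewrite scaler0 addr0 scaleN1r addNr.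
have [->|y0] := eqVneq y 0; first by rewrite T0 !normr0 mulr0.
rewrite -ler_pdivrMr ?normr_gt0//.
have Tu : T (`|y|^-1 *: y) = `|y|^-1 *: T y.
  by have := Tlin `|y|^-1 y 0 Yy Y0; rewrite T0 !addr0.
have -> : `|T y| / `|y| = `|T (`|y|^-1 *: y)|.
  by rewrite Tu normrZ normfV normr_id mulrC.
apply: ub_le_sup; first exact: has_ubound_operator_norm.
exists (`|y|^-1 *: y) => //; split; first by have := YD `|y|^-1 y 0 Yy Y0; rewrite addr0.
by rewrite normrZ normfV normr_id mulVf// normr_eq0.
Qed.

Lemma operator_norm_le (N : R) : Y 0 -> 0 <= N ->
  (forall y, Y y -> `|T y| <= N * `|y|) -> operator_norm_on Y T <= N.
Proof.
move=> Y0 N0 TN; apply: ge_sup => [|_ [y [Yy y1] <-]].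
  by exists `|T 0|, 0 => //; split; rewrite ?normr0.
by apply: le_trans (TN _ Yy) _; rewrite -[leRHS]mulr1 ler_wpM2l.
Qed.

Lemma operator_norm_ge0 : linear_subspace Y -> bounded_operator_on Y T ->
  0 <= operator_norm_on Y T.
Proof.
move=> [Y0 _] bT; apply: (@le_trans _ _ `|T 0|) => //.
apply: ub_le_sup; last by exists 0 => //; split; rewrite ?normr0.
exact: has_ubound_operator_norm.
Qed.
End operator_norm.

Section composition_range.
Context (R : realType) (K L : topologicalType).
Context (cK : compact [set: K]) (cL : compact [set: L]).
Context (phi : continuousType K L).
Local Notation Y := (range (@composition_map R K L cK cL phi)).

Lemma linear_subspace_range : linear_subspace Y.
Proof.
split=> [|a _ _ [f _ <-] [g _ <-]].
  by exists 0 => //; apply: cspaceP.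
by exists (a *: f + g) => //; apply: cspaceP.
Qed.

(** A norm limit f of functions of the form h o phi is constant on the fibres
    of phi; the function g that it induces on L is a uniform limit of the h,
    hence continuous. *)
Lemma closed_range : set_surj [set: K] [set: L] phi -> closed Y.
Proof.
move=> surj_phi f clf.
have approx (e : R) : 0 < e -> exists h : cspace R cL,
    forall x, `|cfun f x - cfun h (phi x)| <= e.
  move=> e0; have [_ [[h _ <-]]] := clf _ (nbhsx_ballx f e e0).
  rewrite -ball_normE => /= fh; exists h => x; apply: le_trans (ltW fh).
  exact: (cfun_le_norm (f - composition_map cK phi h) x).
have sec q : exists x, phi x = q by have [x _ <-] := surj_phi q I; exists x.
pose g q := cfun f (projT1 (cid (sec q))).
have fg x : g (phi x) = cfun f x.
  rewrite /g; case: cid => y /= yx; apply/eqP; rewrite -subr_eq0 -normr_le0.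
  apply/ler_addgt0Pl => e e0; rewrite addr0.
  have e20 : 0 < e / 2 by lra.
  have [h fh] := approx _ e20.
  by have := fh x; have := fh y; rewrite yx !ler_norml; lra.
have cg : continuous g.
  move=> q; apply/cvgrPdist_le => e e0; have e30 : 0 < e / 3 by lra.
  have [h fh] := approx _ e30.
  have gh r : `|g r - cfun h r| <= e / 3.
    by have [x <-] := sec r; rewrite fg.
  have /cvgrPdist_le/(_ _ e30) := @cfun_continuous _ _ cL h q.
  apply: filterS => r; have := gh q; have := gh r.
  by rewrite !ler_norml; lra.
exists (mkcts cg : cspace R cL) => //; apply: cspaceP => x.
exact: fg.
Qed.

End composition_range.

(** * The extension property *)

Theorem c0_extension_composition (R : realType) (d : Order.disp_t)
    (K : orderTopologicalType d) (cK : compact [set: K])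
    (L : topologicalType) (cL : compact [set: L]) (phi : continuousType K L) :
  hausdorff_space L -> countable [set: L] -> set_surj [set: K] [set: L] phi ->
  (forall p : L, countable_union_of_intervals (phi @^-1` [set p])) ->
  c0_extension_property 2 (range (@composition_map R K L cK cL phi)).
Proof.
move=> hL ctL surj_phi intervals; set Y := range _.
have linY : linear_subspace Y by exact: linear_subspace_range.
split; first by have [Y0 YD] := linY; split=> //; exact: closed_range.
move=> T bT; set M := operator_norm_on Y T.
have M0 : 0 <= M by exact: operator_norm_ge0.
have TM : forall y, Y y -> `|T y| <= M * `|y| by exact: le_operator_norm.
pose E := fibre_endpoint phi.
pose p (f : cspace R cK) := sup_norm (fun x : {x | E x} => cfun f (sval x)).
have bnd (f : cspace R cK) (x : {x | E x}) : `|cfun f (sval x)| <= `|f|.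
  exact: cfun_le_norm.
have sp : seminorm p.
  split=> [f g|a f]; first exact: sup_normD (bnd f) (bnd g).
  exact: sup_normZ (bnd f).
have p_le (f : cspace R cK) : p f <= `|f| by apply: sup_norm_le => // x; exact: bnd.
have pY (f : cspace R cK) : Y f -> `|f| <= p f.
  move=> [g _ <-]; apply: cspace_norm_le => [|x]; first exact: sup_norm_ge0.
  have [y Ey yx] := fibre_endpoint_surj cK hL (@cts_fun _ _ phi) x.
  rewrite composition_mapE -yx -(composition_mapE cK phi g).
  exact: (le_sup_norm (exist _ y Ey) (bnd (composition_map cK phi g))).
have [H [ctH dense]] := separable_on_countable_closed R cK
  (@closed_fibre_endpoint _ _ _ phi) (countable_fibre_endpoint ctL intervals).
have [|n|n y Yy|y Yy|D [Dlin DT Dp D0]] := @sobczyk R (cspace R cK) (fun f => M * p f)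
    (seminormZ_ge0 sp M0) Y H (fun n f => c0_val (T f) n) linY ctH.
- move=> S linS HS f e e0.
  have M1 : 0 < M + 1 by lra.
  (* M may be 0, hence the division by M + 1. *)
  have [g Sg fg] := dense S linS HS f (e / (M + 1)) (divr_gt0 e0 M1).
  exists g => //; apply: (@le_trans _ _ ((M + 1) * (e / (M + 1)))).
    apply: ler_pM => //; [exact: seminorm_ge0|lra|].
    apply: sup_norm_le => [|[x Ex]]; first by rewrite divr_ge0 ?ltW.
    exact: fg.
  by rewrite mulrCA mulfV ?mulr1// gt_eqF.
- move=> a u v Yu Yv; have [Tlin _] := bT.
  by rewrite Tlin.
- apply: le_trans (_ : `|T y| <= _).
    by have [N TN] := c0_bounded (T y); exact: le_sup_norm TN.
  by apply: le_trans (TM _ Yy) _; rewrite ler_wpM2l// pY.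
- exact: c0_cvg.
have Dnull (f : cspace R cK) : (D ^~ f) \in null_sequence R by rewrite inE; exact: D0.
pose T' f : c0 R := C0Seq (Dnull f).
have T'M f : `|T' f| <= 2 * M * `|f|.
  apply: sup_norm_le => [|n]; first by rewrite !mulr_ge0.
  apply: le_trans (Dp n f) _; rewrite -mulrA ler_wpM2l//.
  by rewrite ler_wpM2l.
exists T'; split.
- split; last by exists (2 * M).
  by move=> a f g _ _; apply: val_inj; apply/funext => n; exact: Dlin.
- by move=> y Yy; apply: val_inj; apply/funext => n; exact: DT.
- by apply: operator_norm_le => //; rewrite mulr_ge0.
Qed.

Lemma increasing_fibre_interval (d d' : Order.disp_t) (K : porderType d)
    (L : porderType d') (phi : K -> L) :
  {homo phi : x y / (x <= y)%O} ->
  forall p : L, countable_union_of_intervals (phi @^-1` [set p]).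
Proof.
move=> homo_phi p; exists (fun=> phi @^-1` [set p]); split; last first.
  by rewrite bigcup_const //; exists 0%N.
move=> _ x y /= px py z /andP[xz zy]; apply/eqP; rewrite eq_le.
by apply/andP; split; [rewrite -py|rewrite -px]; exact: homo_phi.
Qed.

Theorem corollary2p6 (R : realType) (d : Order.disp_t)
    (K : orderTopologicalType d) (cK : compact [set: K]) :
  (forall (L : topologicalType) (cL : compact [set: L])
      (phi : continuousType K L),
    hausdorff_space L -> countable [set: L] ->
    set_surj [set: K] [set: L] phi ->
    (forall p : L, countable_union_of_intervals (phi @^-1` [set p])) ->
    c0_extension_property 2 (range (@composition_map R K L cK cL phi))) /\
  (forall (d' : Order.disp_t) (L : orderTopologicalType d')
      (phi : continuousType K L),
    compact [set: L] -> countable [set: L] ->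
    set_surj [set: K] [set: L] phi ->
    {homo phi : x y / (x <= y)%O} ->
    forall p : L, countable_union_of_intervals (phi @^-1` [set p])).
Proof.
split=> [L cL phi|d' L phi _ _ _]; first exact: c0_extension_composition.
exact: increasing_fibre_interval.
Qed.
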